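(* For all positive integers $r$ and $k$, the boolean number of the complete bipartite graph $K_{r,k}$ is $$\beta(K_{r,k})=\sum_{j=1}^{r}(-1)^{r-j}\,j!\,\begin{Bmatrix} r+1\\ j+1\end{Bmatrix}\,j^k,$$ where $\begin{Bmatrix} r+1\\ j+1\end{Bmatrix}$ denotes a Stirling number of the second kind.
   Context: Boolean number: for a finite simple graph $G$, the integer $\beta(G)$ is the (well-defined, isomorphism-invariant) quantity determined recursively by $\beta(\emptyset)=1$ for the empty graph, $\beta(\delta_n)=0$ where $\delta_n$ ($n\ge1$) is the graph of $n$ isolated vertices, and, for any edge $e$ of $G$, $\beta(G)=\beta(G-e)+\beta(G/e)+\beta(G-[e])$. Here $G-e$ deletes the edge $e$; $G/e$ contracts $e$ and then removes loops and redundant (parallel) edges; $G-[e]$ removes $e$ together with both its end vertices (and all edges incident to them). It is known that the recursion is independent of choices, and that $\beta(G)$ is the number of spheres of dimension $|G|-1$ in the wedge of spheres to which the boolean complex of $G$ is homotopy equivalent (the boolean complex being the regular cell complex of the simplicial poset of words in distinct vertices of $G$, ordered by substring inclusion, modulo commuting letters that are non-adjacent in $G$). The Stirling number of the second kind $\begin{Bmatrix} n\\ k\end{Bmatrix}$ is the number of partitions of an $n$-element set into $k$ nonempty blocks. *)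

(* Defs.v *)
From HB Require Import structures.
From mathcomp Require Import all_boot all_order all_algebra ring.
Set Implicit Arguments.
Unset Strict Implicit.
Unset Printing Implicit Defensive.
Import GRing.Theory.
Local Open Scope ring_scope.

Record sgraph := SGraph {
  vertex :> finType;
  adj : rel vertex;
  adj_sym : symmetric adj;
  adj_irrefl : irreflexive adj }.

Arguments adj {s} : rename.
Arguments SGraph : clear implicits.

Section Operations.
Variables (G : sgraph) (x y : G).

Definition del_adj : rel G :=
  fun u v => adj u v && ~~ ((u == x) && (v == y) || (u == y) && (v == x)).

Lemma del_adj_sym : symmetric del_adj.
Proof.
by move=> u v; rewrite /del_adj adj_sym orbC (andbC (u == x)) (andbC (u == y)).
Qed.

Lemma del_adj_irrefl : irreflexive del_adj.
Proof. by move=> u; rewrite /del_adj adj_irrefl. Qed.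

Definition delete_edge : sgraph := SGraph G del_adj del_adj_sym del_adj_irrefl.

(* The vertex y is removed, and x plays the role of the merged vertex.  As the
   adjacency is a relation, parallel edges disappear automatically, while the
   condition a != b discards loops. *)
Definition contr_adj : rel {z : G | z != y} :=
  fun a b => (a != b) && [|| adj (val a) (val b),
    (val a == x) && adj y (val b) | (val b == x) && adj (val a) y].

Lemma contr_adj_sym : symmetric contr_adj.
Proof.
move=> a b; rewrite /contr_adj eq_sym (adj_sym (val a) (val b)).
by rewrite (adj_sym y (val b)) (adj_sym y (val a)) [X in _ || X]orbC.
Qed.

Lemma contr_adj_irrefl : irreflexive contr_adj.
Proof. by move=> a; rewrite /contr_adj eqxx. Qed.

Definition contract_edge : sgraph :=
  SGraph {z : G | z != y} contr_adj contr_adj_sym contr_adj_irrefl.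

Definition ext_adj : rel {z : G | (z != x) && (z != y)} :=
  fun a b => adj (val a) (val b).

Lemma ext_adj_sym : symmetric ext_adj.
Proof. by move=> a b; apply: adj_sym. Qed.

Lemma ext_adj_irrefl : irreflexive ext_adj.
Proof. by move=> a; apply: adj_irrefl. Qed.

Definition extract_edge : sgraph :=
  SGraph {z : G | (z != x) && (z != y)} ext_adj ext_adj_sym ext_adj_irrefl.

End Operations.

(* Number of ordered pairs of adjacent vertices, i.e. twice the number of
   edges; it decreases under each of the three operations. *)
Definition adj_count (G : sgraph) : nat := #|[pred p : G * G | adj p.1 p.2]|.

(* The recursion is carried out on an edge selected by [pick]; the theorem
   boolean_number_edge below shows that any other edge gives the same value.
   The first argument bounds the number of recursive calls. *)
Fixpoint boolean_number_rec (n : nat) (G : sgraph) : int :=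
  if [pick p : G * G | adj p.1 p.2] is Some p then
    if n is m.+1 then
      boolean_number_rec m (delete_edge p.1 p.2)
      + boolean_number_rec m (contract_edge p.1 p.2)
      + boolean_number_rec m (extract_edge p.1 p.2)
    else 0
  else if #|G| == 0%N then 1 else 0.

Definition boolean_number (G : sgraph) : int :=
  boolean_number_rec (adj_count G) G.

Section CompleteBipartite.
Variables r k : nat.

Definition bip_adj : rel ('I_r + 'I_k)%type :=
  fun u v => match u, v with
             | inl _, inr _ | inr _, inl _ => true
             | _, _ => false
             end.

Lemma bip_adj_sym : symmetric bip_adj.
Proof. by do 2!case=> ?. Qed.

Lemma bip_adj_irrefl : irreflexive bip_adj.
Proof. by case. Qed.

Definition complete_bipartite : sgraph :=
  SGraph ('I_r + 'I_k)%type bip_adj bip_adj_sym bip_adj_irrefl.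

End CompleteBipartite.

Definition stirling2 (n k : nat) : nat :=
  #|[set P : {set {set 'I_n}} | partition P [set: 'I_n] & #|P| == k]|.

(* The remainder of the file shows that boolean_number satisfies the defining
   recursion for every edge, by means of a closed formula: an alternating sum,
   over k, of the number of colourings of a subset of the vertices (the others
   get None) which are proper and use all of k colours. *)

Lemma card_can (A B : finType) (P : pred A) (Q : pred B) (h : A -> B)
    (g : B -> A) :
  (forall a, P a -> Q (h a) /\ g (h a) = a) ->
  (forall b, Q b -> P (g b) /\ h (g b) = b) -> #|P| = #|Q|.
Proof.
move=> hP gQ.
rewrite -(card_in_image (f := h) (A := P)); last first.
  by move=> a b /hP[_ Ea] /hP[_ Eb] E; rewrite -Ea -Eb E.
apply: eq_card => b; apply/imageP/idP.
  by case=> a /hP[Qa _] ->.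
by move=> /gQ[Pb Eb]; exists (g b).
Qed.

Definition partial_col (G : sgraph) (k : nat) :
    pred {ffun G -> option 'I_k} :=
  fun f => [forall c, exists v, f v == Some c] &&
    [forall u, forall v, adj u v && (f u == f v) ==> (f u == None)].

Definition npcol (G : sgraph) (k : nat) : nat := #|@partial_col G k|.

Lemma partial_colP (G : sgraph) k (f : {ffun G -> option 'I_k}) :
  reflect ((forall c, exists v, f v = Some c) /\
           (forall u v, adj u v -> f u = f v -> f u = None))
          (partial_col f).
Proof.
apply: (iffP andP) => [[/forallP Hs /forallP Hp]|[Hs Hp]]; split.
- by move=> c; have /existsP[v /eqP] := Hs c; exists v.
- move=> u v uv E; have /forallP/(_ v) := Hp u.
  by rewrite uv E eqxx /= => /eqP.
- by apply/forallP=> c; apply/existsP; have [v /eqP] := Hs c; exists v.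
- apply/forallP=> u; apply/forallP=> v; apply/implyP=> /andP[uv /eqP E].
  exact/eqP/(Hp _ v).
Qed.

Section DeletionContraction.
Variables (G : sgraph) (x y : G) (k : nat).
Hypothesis xy : adj x y.

Let x_neq_y : x != y.
Proof. by apply/eqP=> E; move: xy; rewrite E adj_irrefl. Qed.

Let w : contract_edge x y := Sub x x_neq_y.

Let res_c (f : {ffun delete_edge x y -> option 'I_k}) :
    {ffun contract_edge x y -> option 'I_k} := [ffun a => f (val a)].

Let lift_c (g : {ffun contract_edge x y -> option 'I_k}) :
    {ffun delete_edge x y -> option 'I_k} := [ffun v => g (insubd w v)].

Let lift_cE g v (vy : v != y) : lift_c g v = g (Sub v vy).
Proof. by rewrite ffunE; congr (g _); apply: val_inj; rewrite val_insubd vy. Qed.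

Let lift_cy g : lift_c g y = g w.
Proof. by rewrite ffunE; congr (g _); apply: val_inj; rewrite val_insubd eqxx. Qed.

Let lift_cx g : lift_c g x = g w.
Proof. by rewrite (lift_cE _ x_neq_y). Qed.

Let card_split :
  npcol (delete_edge x y) k =
  (npcol G k + #|[pred f | partial_col f & (f w != None)]
     : pred {ffun contract_edge x y -> option 'I_k}|)%N.
Proof.
pose same := [pred f : {ffun delete_edge x y -> option 'I_k} |
  (f x == f y) && (f x != None)].
rewrite /npcol -(cardID same) addnC; congr (_ + _)%N.
  apply: eq_card => f; rewrite !inE.
  apply/idP/partial_colP.
    move=> /andP[nsame /partial_colP[Hs Hp]]; split=> // u v uv E.
    have [/orP|Nuv] :=
      boolP ((u == x) && (v == y) || (u == y) && (v == x)); last first.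
      by apply: (Hp u v) => //=; rewrite /del_adj uv.
    have fxN : f x = f y -> f x = None.
      by move=> E'; apply/eqP; move: nsame; rewrite negb_and negbK E' eqxx.
    by case=> /andP[/eqP Eu /eqP Ev]; move: E; rewrite Eu Ev => E;
      [apply: fxN | rewrite E; apply: fxN].
  case=> Hs Hp; apply/andP; split; last first.
    by apply/partial_colP; split=> // u v /andP[uv _]; apply: Hp.
  by apply/negP=> /andP[/eqP E /eqP]; apply; apply: Hp xy E.
apply: (@card_can _ _ _ _ res_c lift_c) => [f|g].
  move=> /andP[/partial_colP[Hs Hp] /andP[/eqP E N]]; split.
    apply/andP; split; last by rewrite ffunE.
    apply/partial_colP; split.
      move=> c; have [v Ev] := Hs c; have [Evy|vy] := eqVneq v y.
        by exists w; rewrite ffunE /= E -Evy.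
      by exists (Sub v vy); rewrite ffunE.
    move=> a b /andP[ab /or3P[adab|/andP[/eqP ax yb]|/andP[/eqP bx ay]]];
      rewrite !ffunE => Eab.
    - apply: (Hp _ (val b)) => //=; rewrite /del_adj adab /=.
      by rewrite (negbTE (valP a)) (negbTE (valP b)) andbF.
    - rewrite ax E; apply: (Hp _ (val b)); last by rewrite -Eab ax E.
      rewrite /= /del_adj yb eqxx eq_sym (negbTE x_neq_y) /=.
      by apply: contraNN ab => /eqP bx; rewrite -val_eqE /= ax bx.
    - apply: (Hp _ y); last by rewrite Eab bx.
      rewrite /= /del_adj ay eqxx andbT [y == x]eq_sym (negbTE x_neq_y) andbF.
      rewrite orbF; apply: contraNN ab => /eqP ax.
      by rewrite -val_eqE /= ax bx.
  apply/ffunP=> v; have [->|vy] := eqVneq v y.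
    by rewrite lift_cy ffunE.
  by rewrite lift_cE ffunE.
move=> /andP[/partial_colP[Hs Hp] N]; split; last first.
  by apply/ffunP=> -[v vy]; rewrite ffunE /= lift_cE.
apply/andP; split; last first.
  apply/andP; split; first exact/eqP/(etrans (lift_cx g))/esym/lift_cy.
  by apply/eqP=> E; move/eqP: N; apply; apply: etrans (esym (lift_cx g)) E.
apply/partial_colP; split=> [c|u v].
  by have [[v vy] E] := Hs c; exists v; rewrite lift_cE.
move=> /andP[uv Nuv].
have [Eu|uy] := eqVneq u y; have [Ev|vy] := eqVneq v y.
- by move: uv; rewrite Eu Ev adj_irrefl.
- rewrite {1 2}Eu lift_cy !lift_cE; apply: Hp.
  have vx : v != x by move: Nuv; rewrite Eu eqxx eq_sym (negbTE x_neq_y).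
  by rewrite /= /contr_adj -val_eqE /= eq_sym vx eqxx -Eu uv !orbT.
- rewrite Ev lift_cy !lift_cE; apply: Hp.
  have ux : u != x.
    by move: Nuv; rewrite Ev eqxx [y == x]eq_sym (negbTE x_neq_y) andbF orbF andbT.
  by rewrite /= /contr_adj -val_eqE /= ux eqxx -Ev uv !orbT.
- rewrite !lift_cE; apply: Hp; rewrite /= /contr_adj -val_eqE /= uv.
  by rewrite andbT; apply/eqP=> Euv; move: uv; rewrite Euv adj_irrefl.
Qed.

Let res_e (f : {ffun contract_edge x y -> option 'I_k}) :
    {ffun extract_edge x y -> option 'I_k} :=
  [ffun a => f (insubd w (val a))].

Let lift_e (g : {ffun extract_edge x y -> option 'I_k}) :
    {ffun contract_edge x y -> option 'I_k} :=
  [ffun a => if insub (val a) is Some b then g b else None].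

Let val_insubd_e (a : extract_edge x y) : val (insubd w (val a)) = val a.
Proof. by rewrite val_insubd; case/andP: (valP a) => _ ->. Qed.

Let lift_ew g : lift_e g w = None.
Proof. by rewrite ffunE /= insubF ?eqxx. Qed.

Let lift_eE g (a : extract_edge x y) : lift_e g (insubd w (val a)) = g a.
Proof. by rewrite ffunE val_insubd_e valK. Qed.

Let wVe (a : contract_edge x y) :
  a = w \/ exists b : extract_edge x y, a = insubd w (val b).
Proof.
have [ax|ax] := eqVneq (val a) x; first by left; apply: val_inj.
right; have Pa : (val a != x) && (val a != y) by rewrite ax (valP a).
by exists (Sub (val a) Pa); apply: val_inj; rewrite val_insubd_e.
Qed.

Let card_extract :
  #|[pred f | partial_col f & (f w == None)]
     : pred {ffun contract_edge x y -> option 'I_k}|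
  = npcol (extract_edge x y) k.
Proof.
apply: (@card_can _ _ _ _ res_e lift_e) => [f|g].
  move=> /andP[/partial_colP[Hs Hp] /eqP N]; split.
    apply/partial_colP; split=> [c|a b ab].
      have [a Ea] := Hs c; case: (wVe a) => [Ew|[b Eb]].
        by move: Ea; rewrite Ew N.
      by exists b; rewrite ffunE -Eb.
    rewrite !ffunE; apply: Hp.
    rewrite /= /contr_adj !val_insubd_e; apply/andP; split; last first.
      by apply/orP; left; apply: ab.
    apply/eqP=> /(congr1 val); rewrite !val_insubd_e => Eab.
    by move: ab; rewrite /= /ext_adj Eab adj_irrefl.
  apply/ffunP=> a; case: (wVe a) => [->|[b ->]].
    by rewrite lift_ew N.
  by rewrite lift_eE ffunE.
move=> /partial_colP[Hs Hp]; split; last first.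
  by apply/ffunP=> a; rewrite ffunE lift_eE.
apply/andP; split; last by rewrite /= lift_ew.
apply/partial_colP; split=> [c|a b].
  by have [a Ea] := Hs c; exists (insubd w (val a)); rewrite lift_eE.
case: (wVe a) => [->|[a' ->]]; first by rewrite lift_ew.
case: (wVe b) => [->|[b' ->]]; first by rewrite lift_ew.
rewrite !lift_eE => /andP[_]; rewrite !val_insubd_e.
case/andP: (valP a') => /negbTE -> _; case/andP: (valP b') => /negbTE -> _.
by rewrite !orbF => ab; apply: Hp.
Qed.

Lemma npcol_edge :
  (npcol (delete_edge x y) k + npcol (extract_edge x y) k =
   npcol G k + npcol (contract_edge x y) k)%N.
Proof.
rewrite card_split -card_extract -addnA; congr (_ + _)%N.
rewrite /npcol addnC -[RHS](cardID [pred f : {ffun contract_edge x y -> option 'I_k} | f w == None]).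
by congr (_ + _)%N; apply: eq_card => f; rewrite !inE andbC.
Qed.

End DeletionContraction.

Lemma npcol_gt (G : sgraph) k : (#|G| < k)%N -> npcol G k = 0%N.
Proof.
move=> ltk; apply: eq_card0 => f; apply/negP=> /partial_colP[Hs _].
move: ltk; rewrite ltnNge => /negP; apply.
rewrite -[k]card_ord -(card_image (f := @Some 'I_k)) => [|? ? []//].
apply: leq_trans (leq_image_card f G).
apply/subset_leq_card/subsetP=> _ /imageP[c _ ->].
by have [v <-] := Hs c; apply: image_f.
Qed.

Section Edgeless.
Variable G : sgraph.
Hypothesis edgeless : forall u v : G, ~~ adj u v.
Hypothesis G_gt0 : (0 < #|G|)%N.

Let nsurj k := #|[pred f : {ffun G -> 'I_k} | [forall c, c \in codom f]]|.

Let nsurj_gt k : (#|G| < k)%N -> nsurj k = 0%N.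
Proof.
move=> ltk; apply: eq_card0 => f; apply/negP; rewrite inE => /forallP Hs.
move: ltk; rewrite ltnNge => /negP; apply.
rewrite -[k in (k <= _)%N]card_ord; apply: leq_trans (leq_image_card f G).
by apply/subset_leq_card/subsetP=> c _; apply: Hs.
Qed.

Let nsurj0 : nsurj 0 = 0%N.
Proof.
by case/card_gt0P: G_gt0 => v _; apply: eq_card0 => f; case: (f v).
Qed.

Let edgeless_colP k (f : {ffun G -> option 'I_k}) :
  reflect (forall c, exists v, f v = Some c) (partial_col f).
Proof.
apply: (iffP (partial_colP f)) => [[]//|Hs]; split=> // u v.
by rewrite (negbTE (edgeless u v)).
Qed.

Let npcol_edgeless k : npcol G k = (nsurj k.+1 + nsurj k)%N.
Proof.
rewrite /npcol -(cardID [pred f : {ffun G -> option 'I_k} | None \in codom f]).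
congr (_ + _)%N.
  pose h (f : {ffun G -> option 'I_k}) : {ffun G -> 'I_k.+1} :=
    [ffun v => if f v is Some c then lift ord0 c else ord0].
  pose g (f : {ffun G -> 'I_k.+1}) : {ffun G -> option 'I_k} :=
    [ffun v => unlift ord0 (f v)].
  apply: (@card_can _ _ _ _ h g) => f.
    move=> /andP[/edgeless_colP Hs /codomP[v0 Ev0]]; split.
      apply/forallP=> c; case: (unliftP ord0 c) => [c' ->|->].
        have [v Ev] := Hs c'; apply/codomP; exists v.
        by rewrite ffunE Ev.
      by apply/codomP; exists v0; rewrite ffunE -Ev0.
    apply/ffunP=> v; rewrite !ffunE; case: (f v) => [c|].
      by rewrite liftK.
    by rewrite unlift_none.
  move=> /forallP Hs; split.
    apply/andP; split.
      apply/edgeless_colP=> c; have /codomP[v Ev] := Hs (lift ord0 c).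
      by exists v; rewrite ffunE -Ev liftK.
    have /codomP[v Ev] := Hs ord0; apply/codomP; exists v.
    by rewrite ffunE -Ev unlift_none.
  by apply/ffunP=> v; rewrite !ffunE; case: unliftP.
case: k => [|k].
  rewrite nsurj0; apply: eq_card0 => f; apply/negP=> /andP[/= nN _].
  case/card_gt0P: G_gt0 => v _; case/negP: nN; apply/codomP; exists v.
  by case: (f v) => [[]|].
pose h (f : {ffun G -> option 'I_k.+1}) : {ffun G -> 'I_k.+1} :=
  [ffun v => odflt ord0 (f v)].
pose g (f : {ffun G -> 'I_k.+1}) : {ffun G -> option 'I_k.+1} :=
  [ffun v => Some (f v)].
apply: (@card_can _ _ _ _ h g) => f.
  move=> /andP[nN /edgeless_colP Hs]; split.
    apply/forallP=> c; have [v Ev] := Hs c.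
    by apply/codomP; exists v; rewrite ffunE Ev.
  apply/ffunP=> v; rewrite !ffunE; case E: (f v) => //.
  by case/negP: nN; apply/codomP; exists v.
move=> /forallP Hs; split; last by apply/ffunP=> v; rewrite !ffunE.
apply/andP; split.
  by apply/negP=> /codomP[v]; rewrite ffunE.
apply/edgeless_colP=> c; have /codomP[v Ev] := Hs c.
by exists v; rewrite ffunE Ev.
Qed.

Lemma sum_npcol_edgeless :
  \sum_(0 <= k < #|G|.+1) (-1) ^+ (#|G| + k) * (npcol G k)%:R = 0 :> int.
Proof.
pose s k : int := - (-1) ^+ (#|G| + k) * (nsurj k)%:R.
rewrite (eq_bigr (fun k => s k.+1 - s k)) => [|k _].
  rewrite telescope_sumr // /s nsurj0 nsurj_gt //.
  by rewrite !mulr0 subrr.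
by rewrite npcol_edgeless natrD mulrDr /s addnS exprS mulN1r opprK mulNr opprK.
Qed.

End Edgeless.

Definition boolean_sum (G : sgraph) : int :=
  \sum_(0 <= k < #|G|.+1) (-1) ^+ (#|G| + k) * (npcol G k)%:R.

Lemma boolean_sum_widen (G : sgraph) n : (#|G| <= n)%N ->
  boolean_sum G = \sum_(0 <= k < n.+1) (-1) ^+ (#|G| + k) * (npcol G k)%:R.
Proof.
move=> le_n; rewrite [RHS](big_cat_nat (n := #|G|.+1)) //=.
rewrite [X in _ + X]big_nat_cond [X in _ + X]big1 ?addr0 // => k.
by rewrite andbT => /andP[lt_k _]; rewrite npcol_gt // mulr0.
Qed.

Lemma boolean_sum_edgeless (G : sgraph) :
  (forall u v : G, ~~ adj u v) -> boolean_sum G = (#|G| == 0%N)%:R.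
Proof.
move=> no_adj; rewrite /boolean_sum.
case: posnP => [G0|G_gt0]; last exact: sum_npcol_edgeless.
rewrite G0 big_nat1 expr0 mul1r; congr _%:R.
apply/eqP; rewrite eqn_leq; apply/andP; split.
  by apply: leq_trans (max_card _) _; rewrite card_ffun G0 expn0.
apply/card_gt0P; exists [ffun=> None]; apply/partial_colP.
by split=> [[]|u v]; rewrite ?(negbTE (no_adj _ _)).
Qed.

Lemma card_contract (G : sgraph) (x y : G) :
  #|contract_edge x y|.+1 = #|G|.
Proof. by rewrite card_sig cardC1 prednK //; apply/card_gt0P; exists x. Qed.

Lemma card_extract (G : sgraph) (x y : G) : adj x y ->
  #|extract_edge x y|.+2 = #|G|.
Proof.
move=> xy; have nxy : x != y by apply/eqP=> E; move: xy; rewrite E adj_irrefl.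
rewrite card_sig -(cardC (pred2 x y)) card2 nxy; congr (_.+2).
by apply: eq_card => z; rewrite !inE negb_or.
Qed.

Lemma boolean_sum_edge (G : sgraph) (x y : G) : adj x y ->
  boolean_sum G = boolean_sum (delete_edge x y)
    + boolean_sum (contract_edge x y) + boolean_sum (extract_edge x y).
Proof.
move=> xy; have Ec := card_contract x y; have Ee := card_extract xy.
rewrite (boolean_sum_widen (n := #|G|) (G := contract_edge _ _)) -?Ec //.
rewrite Ec (boolean_sum_widen (n := #|G|) (G := extract_edge _ _)); last first.
  by rewrite -Ee -addn2 leq_addr.
rewrite /boolean_sum -!big_split /=; apply: eq_bigr => k _.
have /(congr1 (fun n => n%:R : int))/esym := npcol_edge k xy.
rewrite !natrD => /(canRL (addrK _)) ->.
have Eec : #|contract_edge x y| = #|extract_edge x y|.+1.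
  by apply: succn_inj; rewrite Ec Ee.
rewrite -Ec Eec !addSn !exprS; ring.
Qed.

Lemma adj_count_lt (G H : sgraph) (h : H * H -> G * G) (p0 : G * G) :
  adj p0.1 p0.2 ->
  (forall p q, adj p.1 p.2 -> adj q.1 q.2 -> h p = h q -> p = q) ->
  (forall p, adj p.1 p.2 -> adj (h p).1 (h p).2 /\ h p <> p0) ->
  (adj_count H < adj_count G)%N.
Proof.
move=> p0adj h_inj hP; rewrite /adj_count.
rewrite -(@card_in_image _ _ h [pred p : H * H | adj p.1 p.2]) => [|p q].
  apply/proper_card/properP; split.
    by apply/subsetP=> _ /imageP[p /hP[hp _] ->].
  by exists p0 => //; apply/negP=> /imageP[p /hP[_ np] E]; apply: np.
by rewrite !inE; apply: h_inj.
Qed.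

Section AdjCount.
Variables (G : sgraph) (x y : G).
Hypothesis xy : adj x y.

Lemma adj_count_delete : (adj_count (delete_edge x y) < adj_count G)%N.
Proof.
apply: (@adj_count_lt G (delete_edge x y) id (x, y)) => // -[u v] /=.
rewrite /del_adj negb_or => /andP[-> /andP[nxy _]]; split=> // -[Eu Ev].
by move: nxy; rewrite Eu Ev !eqxx.
Qed.

Lemma adj_count_contract : (adj_count (contract_edge x y) < adj_count G)%N.
Proof.
have nxy : x != y by apply/eqP=> E; move: xy; rewrite E adj_irrefl.
pose C := contract_edge x y.
pose h (p : C * C) : G * G :=
  if adj (val p.1) (val p.2) then (val p.1, val p.2)
  else if val p.1 == x then (y, val p.2) else (val p.1, y).
pose g (p : G * G) : G * G :=
  if p.1 == y then (x, p.2) else if p.2 == y then (p.1, x) else p.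
have hK p : adj p.1 p.2 -> g (h p) = (val p.1, val p.2).
  case: p => -[a Pa] [b Pb] /= /andP[_]; rewrite /h /g /=.
  have ay : (a == y) = false := negbTE Pa.
  have by_ : (b == y) = false := negbTE Pb.
  case: (adj a b) => [_|] /=; first by rewrite ay by_.
  case: (eqVneq a x) => [->|_] /=; first by rewrite eqxx.
  by case/andP=> /eqP -> _; rewrite ay eqxx.
apply: (@adj_count_lt G C h (x, y)) => // [p q ap aq E|p ap].
  move: (hK _ ap); rewrite E (hK _ aq) => -[/val_inj E1 /val_inj E2].
  by rewrite (surjective_pairing p) -E1 -E2 -surjective_pairing.
move: ap; case: p => a b /andP[/= ab]; rewrite /h /=.
case E0: (adj (sval a) (sval b)) => /=.
  by rewrite E0; split=> // -[_ E]; case/eqP: (valP b).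
case: (eqVneq (sval a) x) => [ax|nax] /=.
  case/orP=> [yb|/andP[/eqP bx _]].
    by split=> // -[E _]; move: nxy; rewrite E eqxx.
  by move: ab; rewrite -val_eqE /= ax bx eqxx.
by case/andP=> _ ay; split=> // -[/eqP]; rewrite (negbTE nax).
Qed.

Lemma adj_count_extract : (adj_count (extract_edge x y) < adj_count G)%N.
Proof.
apply: (@adj_count_lt G (extract_edge x y)
  (fun p => (val p.1, val p.2)) (x, y)) => // [p q _ _|p ap].
  by case: p q => [a b] [c d] /= -[/val_inj -> /val_inj ->].
by split=> // -[E _]; case/andP: (valP p.1) => /eqP.
Qed.

End AdjCount.

Lemma boolean_numberE (G : sgraph) : boolean_number G = boolean_sum G.
Proof.
suff H n : (adj_count G <= n)%N -> boolean_number_rec n G = boolean_sum G.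
  exact: H.
elim: n G => [|n IHn] G le_n /=; case: pickP => [p ap|no_adj].
- move: le_n; rewrite leqNgt => /negP[]; apply/card_gt0P.
  by exists p.
- rewrite boolean_sum_edgeless => [|u v]; first by case: eqP.
  by have /= -> := no_adj (u, v).
- rewrite (boolean_sum_edge ap) !IHn // -ltnS; apply: leq_trans le_n.
  + exact: adj_count_extract.
  + exact: adj_count_contract.
  + exact: adj_count_delete.
- rewrite boolean_sum_edgeless => [|u v]; first by case: eqP.
  by have /= -> := no_adj (u, v).
Qed.

Theorem boolean_number_edge (G : sgraph) (x y : G) : adj x y ->
  boolean_number G = boolean_number (delete_edge x y)
    + boolean_number (contract_edge x y) + boolean_number (extract_edge x y).
Proof. by rewrite !boolean_numberE; apply: boolean_sum_edge. Qed.

Theorem boolean_number_edgeless (G : sgraph) :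
  (forall u v : G, ~~ adj u v) -> boolean_number G = (#|G| == 0%N)%:R.
Proof. by rewrite boolean_numberE; apply: boolean_sum_edgeless. Qed.

Theorem boolean_number_iso (G H : sgraph) (h : G -> H) :
  bijective h -> (forall u v, adj (h u) (h v) = adj u v) ->
  boolean_number G = boolean_number H.
Proof.
case=> g gK hK h_adj; rewrite !boolean_numberE /boolean_sum.
have -> : #|H| = #|G| by apply/esym/(bij_eq_card (f := h)); exists g.
apply: eq_bigr => k _; congr (_ * _%:R).
pose i (f : {ffun G -> option 'I_k}) : {ffun H -> option 'I_k} :=
  [ffun v => f (g v)].
pose j (f : {ffun H -> option 'I_k}) : {ffun G -> option 'I_k} :=
  [ffun v => f (h v)].
apply: (@card_can _ _ _ _ i j) => f.
  move=> /partial_colP[Hs Hp]; split.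
    apply/partial_colP; split=> [c|u v uv].
      by have [v Ev] := Hs c; exists (h v); rewrite ffunE gK.
    by rewrite !ffunE; apply: Hp; rewrite -h_adj !hK.
  by apply/ffunP=> v; rewrite !ffunE gK.
move=> /partial_colP[Hs Hp]; split.
  apply/partial_colP; split=> [c|u v uv].
    by have [v Ev] := Hs c; exists (g v); rewrite ffunE hK.
  by rewrite !ffunE; apply: Hp; rewrite h_adj.
by apply/ffunP=> v; rewrite !ffunE hK.
Qed.

(* Main.v *)
Require Import Defs.
From mathcomp Require Import all_boot all_order all_algebra ring.
Import GRing.Theory.
Local Open Scope ring_scope.

(** The boolean number is an alternating sum, over [m], of the number of proper
    partial colourings that use all of [m] colours ([boolean_numberE]).  In a
    complete bipartite graph such a colouring is a pair of partial maps, one on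
    each side, whose sets of values are complementary: adjacent coloured
    vertices get different colours exactly when no colour occurs on both sides,
    and all colours are used exactly when the two sets of values cover.  Let
    P(n, j) ([pointed_surj]) be the number of partial maps from n points with a
    prescribed set of j values.  Choosing the j colours used on the side of size
    r gives C(m, j) P(r, j) P(k, m - j) colourings
    ([npcol_complete_bipartite], [sum_card_set]), hence, with m = i + j,

      beta(K_{r,k}) = sum_j (-1)^(r + k + j) P(r, j)
                        sum_i (-1)^i C(i + j, i) P(k, i).

    The inner sum is (-j)^k ([alternating_pointed_surj]).  Indeed (x + 1)^k
    counts all partial maps from k points to x points, so that it equals
    sum_i C(x, i) P(k, i); this is a polynomial identity in x, and at
    x = -(j + 1) the coefficient C(x, i) is (-1)^i C(i + j, i).

    Finally P(r, j) = j! S(r + 1, j + 1) ([pointed_surj_stirling2]): adding to r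
    points an extra one outside the domain, the fibres of a partial map form a
    partition into j + 1 blocks, where the block of the extra point is
    distinguished and the j others are labelled by the values.  The term j = 0
    vanishes because k > 0. *)

(** * Counting partial maps with prescribed values *)

(** The number of partial maps from [n] points onto [j] points or,
    equivalently, of base-point-preserving surjections from [n.+1] points onto
    [j.+1] points.  In the recurrence the first point is left out or repeats one
    of the [j] values taken elsewhere ([j.+1] choices), or it is alone in taking
    one of the [j] values. *)
Fixpoint pointed_surj (n j : nat) : nat :=
  if n is n'.+1 then
    (j.+1 * pointed_surj n' j + j * pointed_surj n' j.-1)%N
  else (j == 0)%N.

Lemma pointed_surj_gt n j : (n < j)%N -> pointed_surj n j = 0%N.
Proof.
elim: n j => [|n IHn] [|j] //= lt_nj.
by rewrite !IHn ?muln0 // ltnW.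
Qed.

(** In the induction on [k] the recurrence for [pointed_surj] turns each summand
    into [- j%:R] times the summand for the previous exponent, up to the
    difference of consecutive values of [s], which telescopes to zero. *)
Lemma alternating_pointed_surj k j n : (k < n)%N ->
  \sum_(0 <= i < n) (-1) ^+ i * 'C(i + j, i)%:R * (pointed_surj k i)%:R
    = (- j%:R) ^+ k :> int.
Proof.
elim: k => [|k IHk] lt_kn.
  rewrite big_ltn // bin0 /= !mulr1 big_nat big1 ?addr0 // => i /andP[i_gt0 _].
  by rewrite eqn0Ngt i_gt0 mulr0.
pose s i : int :=
  - (-1) ^+ i * 'C(i + j, i)%:R * (i%:R * (pointed_surj k i.-1)%:R).
rewrite exprS -IHk ?(ltnW lt_kn) // mulr_sumr.
have s_telescope : \sum_(0 <= i < n) (s i.+1 - s i) = 0.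
  rewrite telescope_sumr // /s pointed_surj_gt; last first.
    by rewrite -ltnS (ltn_predK lt_kn).
  by rewrite !mul0r !mulr0 subrr.
apply/eqP; rewrite -subr_eq0 -sumrB; apply/eqP; rewrite -[RHS]s_telescope.
apply: eq_bigr => i _.
have -> : pointed_surj k.+1 i =
  (i.+1 * pointed_surj k i + i * pointed_surj k i.-1)%N by [].
have /(congr1 (fun m => m%:R : int)) := mul_bin_diag (i + j).+1 i.
rewrite /s [i.+1.-1]/= [(i + j).+1.-1]/= addSn exprS.
move: 'C(i + j, i) 'C((i + j).+1, i.+1) => c c'; rewrite !natrM => E.
have -> u : - (-1 * (-1) ^+ i) * c'%:R * (i.+1%:R * u)
          = (-1) ^+ i * u * (i.+1%:R * c'%:R) :> int by ring.
by rewrite -E natrD !natrM -[(i + j).+1]addn1 -[i.+1]addn1 !natrD; ring.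
Qed.

Definition values {X T : finType} (f : {ffun X -> option T}) : {set T} :=
  [set c | Some c \in codom f].

Lemma valuesP {X T : finType} (f : {ffun X -> option T}) c :
  reflect (exists x, f x = Some c) (c \in values f).
Proof.
by rewrite inE; apply: (iffP codomP) => -[x E]; exists x.
Qed.

(** Only the cardinal of the set of values matters; allowing an arbitrary set
    [A] lets the induction pass to [A :\ c], and lets both sides of the
    bipartite graph share one set of colours. *)
Lemma card_values (T : finType) n (A : {set T}) :
  #|[pred f : {ffun 'I_n -> option T} | values f == A]|
    = pointed_surj n #|A|.
Proof.
elim: n A => [|n IHn] A /=.
  have values0 (f : {ffun 'I_0 -> option T}) : values f = set0.
    by apply/setP=> c; rewrite in_set0; apply/valuesP=> -[[]].
  have [->|A0] := eqVneq A set0.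
    rewrite cards0 (eq_card (B := predT)) => [|f]; last first.
      by rewrite !inE values0 eqxx.
    by rewrite cardT -cardE card_ffun card_ord expn0.
  rewrite cards_eq0 (negbTE A0); apply: eq_card0 => f.
  by rewrite !inE values0 eq_sym (negbTE A0).
(* A map on ['I_n.+1] is the pair of its value at [ord0] and of a map on
   ['I_n]. *)
pose U := (option T * {ffun 'I_n -> option T})%type.
pose cons (p : U) : {ffun 'I_n.+1 -> option T} :=
  [ffun x => oapp p.2 p.1 (unlift ord0 x)].
pose uncons (f : {ffun 'I_n.+1 -> option T}) : U :=
  (f ord0, [ffun x => f (lift ord0 x)]).
have values_cons o f :
    values (cons (o, f)) = oapp (fun c => c |: values f) (values f) o.
  apply/setP=> c; apply/valuesP/idP => [[x]|].
    rewrite ffunE /=; case: unliftP => [y _|_] /= E.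
      by case: o => [d|] /=; rewrite ?in_setU1; [apply/orP; right|];
        apply/valuesP; exists y.
    by rewrite E /= in_setU1 eqxx.
  case: o => [d|] /=.
    rewrite in_setU1 => /orP[/eqP ->|/valuesP[y E]].
      by exists ord0; rewrite ffunE unlift_none.
    by exists (lift ord0 y); rewrite ffunE liftK.
  by case/valuesP=> y E; exists (lift ord0 y); rewrite ffunE liftK.
rewrite (@card_can _ _ _ [pred p : U | values (cons p) == A] uncons cons);
  last 2 first.
- move=> f /= Af; suff E : cons (uncons f) = f by rewrite E.
  apply/ffunP=> x; rewrite ffunE /=; case: unliftP => [y ->|->] //=.
  by rewrite ffunE.
- move=> [o f] /= Af; split=> //.
  rewrite /uncons ffunE unlift_none; congr (_, _).
  by apply/ffunP=> x; rewrite !ffunE liftK.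
rewrite -sum1_card
  (eq_bigl (fun p : U => true && (values (cons (p.1, p.2)) == A)));
  last by case.
rewrite -(pair_big_dep xpredT (fun o f => values (cons (o, f)) == A)
  (fun _ _ => 1%N)) /=.
(* Summation over the value [o] at [ord0]: [None] gives the first summand, and
   [Some c] contributes nothing unless [c] is in [A]. *)
rewrite (bigD1 None) //= (reindex_omap Some id) => [|[]//] /=.
under [X in (_ + X)%N]eq_bigl => c do rewrite eqxx.
rewrite mulSn -addnA.
under eq_bigl do rewrite values_cons /=.
rewrite sum1_card IHn; congr (_ + _)%N.
rewrite (bigID (mem A)) /= [X in (_ + X)%N]big1 ?addn0 => [|c cA]; last first.
  rewrite big_pred0 // => f; rewrite values_cons /=.
  apply/negP=> /eqP E.
  by move: cA; rewrite -E in_setU1 eqxx.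
rewrite -mulnDr -sum_nat_const; apply: eq_bigr => c cA.
have -> : #|A|.-1 = #|A :\ c| by rewrite (cardsD1 c A) cA.
under eq_bigl do rewrite values_cons /=.
rewrite sum1_card -!IHn -[LHS]/#|[pred f | c |: values f == A]|.
(* The other points may or may not take the value [c] again. *)
rewrite -(cardID [pred f : {ffun 'I_n -> option T} | c \in values f]).
congr (_ + _)%N; apply: eq_card => f.
  apply/andP/eqP => [[/= /eqP <- cf]|/= E].
    by apply/esym/setUidPr; rewrite sub1set.
  by split; rewrite -topredE /= E // (setUidPr _) ?sub1set.
apply/andP/eqP => [[/= cf /eqP <-]|/= E]; first by rewrite setU1K.
by split; rewrite -topredE /= E ?setD1K // setD11.
Qed.

(** * Colourings of the complete bipartite graph *)

(** The index [A] is the set of the colours that occur on the side of size [r];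
    the other side uses exactly the remaining ones. *)
Lemma npcol_complete_bipartite r k m :
  npcol (complete_bipartite r k) m =
  \sum_(A : {set 'I_m}) (pointed_surj r #|A| * pointed_surj k #|~: A|)%N.
Proof.
pose L := {ffun 'I_r -> option 'I_m}; pose R := {ffun 'I_k -> option 'I_m}.
pose split (f : {ffun complete_bipartite r k -> option 'I_m}) : L * R :=
  ([ffun u => f (inl u)], [ffun v => f (inr v)]).
pose join (p : L * R) : {ffun complete_bipartite r k -> option 'I_m} :=
  [ffun x => match x with inl u => p.1 u | inr v => p.2 v end].
have splitK : cancel split join.
  by move=> f; apply/ffunP=> -[u|v]; rewrite !ffunE.
have joinK : cancel join split.
  by move=> [f g]; congr (_, _); apply/ffunP=> x; rewrite !ffunE.
have joinP p : partial_col (join p) = (values p.2 == ~: values p.1).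
  apply/partial_colP/eqP => [[Hs Hp]|E].
    apply/setP=> c; rewrite in_setC; apply/idP/idP.
      case/valuesP=> v Ev; apply/negP=> /valuesP[u Eu].
      have := Hp (inl u) (inr v) isT; rewrite !ffunE Eu Ev => /(_ erefl).
      by [].
    have [[u|v]] := Hs c; rewrite ffunE => Ec.
      by case/valuesP; exists u.
    by move=> _; apply/valuesP; exists v.
  have disj u v c : p.1 u = Some c -> p.2 v = Some c -> False.
    move=> Eu Ev; have : c \in values p.2 by apply/valuesP; exists v.
    by rewrite E in_setC => /valuesP[]; exists u.
  split=> [c|[u|v] [u'|v'] // _]; last 2 first.
  - by rewrite !ffunE; case Eu: (p.1 u) => [c|] // /esym/(disj _ _ _ Eu).
  - by rewrite !ffunE; case Ev: (p.2 v) => [c|] // /esym/disj/(_ Ev).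
  have := in_setC c (values p.1); rewrite -E.
  case: valuesP => [[v Ev] _|_ /esym/negPn/valuesP[u Eu]].
    by exists (inr v); rewrite ffunE.
  by exists (inl u); rewrite ffunE.
rewrite /npcol (@card_can _ _ _ [pred p : L * R | values p.2 == ~: values p.1]
  split join); last 2 first.
- move=> f f_col; split=> //.
  change (values (split f).2 == ~: values (split f).1).
  by rewrite -joinP splitK.
- by move=> p /= Ep; split; rewrite ?joinP ?joinK.
rewrite -sum1_card -(pair_big_dep xpredT
  (fun (f : L) (g : R) => values g == ~: values f) (fun _ _ => 1%N)) /=.
rewrite (partition_big values xpredT) //=; apply: eq_bigr => A _.
rewrite -card_values -sum_nat_const; apply: eq_bigr => f /eqP <-.
by rewrite sum1_card card_values.
Qed.

(** The bound [n] may exceed [m.+1], because ['C(m, j)] vanishes for [m < j];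
    this gives the sum a range independent of [m], so that it can be exchanged
    with a sum over [m]. *)
Lemma sum_card_set (m n : nat) (F : nat -> nat) : (m < n)%N ->
  \sum_(A : {set 'I_m}) F #|A| = \sum_(0 <= j < n) ('C(m, j) * F j)%N.
Proof.
move=> lt_mn; rewrite big_mkord.
have lt_card (A : {set 'I_m}) : (#|A| < n)%N.
  by apply: leq_ltn_trans lt_mn; rewrite -[m in (_ <= m)%N]card_ord max_card.
rewrite (partition_big (fun A : {set 'I_m} => Ordinal (lt_card A)) xpredT) //=.
apply: eq_bigr => j _; rewrite -[m in 'C(m, _)]card_ord -card_draws.
rewrite -sum_nat_const; apply: eq_big => [A|A]; first by rewrite inE -val_eqE.
by move=> /eqP <-.
Qed.

Lemma boolean_number_complete_bipartite r k :
  boolean_number (complete_bipartite r k) =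
  \sum_(0 <= j < r.+1) (-1) ^+ (r - j) * (pointed_surj r j)%:R * j%:R ^+ k.
Proof.
pose n := (r + k).+1.
rewrite boolean_numberE /boolean_sum card_sum !card_ord -/n.
pose t m j : int := (-1) ^+ (r + k + m) *
  ('C(m, j)%:R * ((pointed_surj r j)%:R * (pointed_surj k (m - j))%:R)).
rewrite (eq_big_nat _ _ (F2 := fun m => \sum_(0 <= j < n) t m j)); last first.
  move=> m /andP[_ lt_mn]; rewrite npcol_complete_bipartite -mulr_sumr.
  congr (_ * _).
  have cardC (A : {set 'I_m}) : #|~: A| = (m - #|A|)%N.
    by rewrite cardsCs setCK card_ord.
  under eq_bigr => A _ do rewrite cardC.
  rewrite (sum_card_set _ _
    (fun j => pointed_surj r j * pointed_surj k (m - j))%N lt_mn).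
  by rewrite natr_sum; apply: eq_bigr => j _; rewrite !natrM.
(* Once the sums are exchanged, [j] stops at [r] because a set of [r] points has
   at most [r] values, and [m] starts at [j] because of the binomial. *)
rewrite exchange_big_nat /= (big_cat_nat (n := r.+1)) ?ltnS ?leq_addr //=.
rewrite [X in _ + X]big_nat [X in _ + X]big1 ?addr0 => [|j /andP[lt_rj _]];
  last first.
  by apply: big1 => m _; rewrite /t pointed_surj_gt // mul0r !mulr0.
apply: eq_big_nat => j; rewrite ltnS => /andP[_ le_jr].
have le_jn : (j <= n)%N by rewrite leqW // (leq_trans le_jr) ?leq_addr.
rewrite (big_cat_nat (n := j)) //= [X in X + _]big_nat.
rewrite [X in X + _]big1 ?add0r => [|m lt_mj]; last first.
  by rewrite /t bin_small ?mul0r ?mulr0.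
have -> : (-1) ^+ (r - j) * (pointed_surj r j)%:R * j%:R ^+ k =
    (-1) ^+ (r + k + j) * (pointed_surj r j)%:R * (- j%:R) ^+ k :> int.
  rewrite [(- j%:R) ^+ _]exprNn mulrA; congr (_ * _).
  rewrite mulrAC -exprD; congr (_ * _).
  rewrite -signr_odd -[RHS]signr_odd; congr (_ ^+ nat_of_bool _).
  by rewrite oddB // !oddD; case: (odd r) (odd j) (odd k) => [] [] [].
rewrite -{1}[j]add0n big_addn.
rewrite -(@alternating_pointed_surj k j (n - j)); last first.
  by rewrite ltn_subRL /n ltnS leq_add2r.
rewrite mulr_sumr; apply: eq_bigr => i _; rewrite /t addnK.
rewrite -bin_sub ?leq_addl // addnK.
by rewrite (addnC i j) addnA exprD; ring.
Qed.

(** * Stirling numbers *)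

(** Both sides count the partitions of ['I_r.+1] into [j.+1] blocks together
    with a labelling by ['I_j] of the blocks that avoid [ord0]: [ord0] is the point
    added outside the domain of a partial map. *)
Lemma pointed_surj_stirling2 r j :
  pointed_surj r j = (j`! * stirling2 r.+1 j.+1)%N.
Proof.
pose X := 'I_r.+1.
pose ordered := [pred p : {set {set X}} * {ffun 'I_j -> {set X}} |
  (partition p.1 [set: X] && (#|p.1| == j.+1)) &&
  ((p.2 \in ffun_on (mem (p.1 :\ pblock p.1 ord0))) && injectiveb p.2)].
have -> : (j`! * stirling2 r.+1 j.+1)%N = #|ordered|.
  rewrite -[#|ordered|]sum1_card.
  rewrite -(pair_big_dep (fun Q => partition Q [set: X] && (#|Q| == j.+1))
    (fun Q (b : {ffun 'I_j -> {set X}}) =>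
       (b \in ffun_on (mem (Q :\ pblock Q ord0))) && injectiveb b)
    (fun _ _ => 1%N)) /=.
  rewrite /stirling2 mulnC -sum_nat_const; apply: eq_big => [Q|Q].
    by rewrite inE.
  rewrite inE => /andP[Qpart /eqP cardQ].
  have cardB : #|Q :\ pblock Q ord0| = j.
    apply/eqP; rewrite -eqSS -cardQ (cardsD1 (pblock Q ord0) Q).
    by rewrite pblock_mem // (cover_partition Qpart) inE.
  have -> : j`! = (#|Q :\ pblock Q ord0| ^_ #|'I_j|)%N.
    by rewrite cardB card_ord ffactnn.
  by rewrite sum1_card -card_inj_ffuns_on; apply: eq_card => b; rewrite inE.
have -> : pointed_surj r j =
    #|[pred f : {ffun 'I_r -> option 'I_j} | values f == [set: 'I_j]]|.
  by rewrite card_values cardsT card_ord.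
(* [cls f] gives the fibres of the extended map [ext f], and [cls f None] is the
   block of [ord0]. *)
pose ext (f : {ffun 'I_r -> option 'I_j}) (x : X) := obind f (unlift ord0 x).
pose cls f o : {set X} := [set x | ext f x == o].
pose h f : {set {set X}} * {ffun 'I_j -> {set X}} :=
  ([set cls f o | o : option 'I_j], [ffun c => cls f (Some c)]).
pose g (p : {set {set X}} * {ffun 'I_j -> {set X}}) :
    {ffun 'I_r -> option 'I_j} :=
  [ffun y => [pick c | lift ord0 y \in p.2 c]].
apply: (@card_can _ _ _ _ h g) => [f /eqP f_onto|[Q b]].
  have ext_onto o : exists x, ext f x = o.
    case: o => [c|]; last by exists ord0; rewrite /ext unlift_none.
    have : c \in values f by rewrite f_onto inE.
    by case/valuesP=> y Ey; exists (lift ord0 y); rewrite /ext liftK.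
  have cls_inj : injective (cls f).
    move=> o o' E; have [x Ex] := ext_onto o.
    have : x \in cls f o by rewrite inE Ex.
    by rewrite E inE Ex => /eqP.
  have hpart : partition [set cls f o | o : option 'I_j] [set: X].
    apply/and3P; split.
    - rewrite eqEsubset subsetT; apply/subsetP=> x _; apply/bigcupP.
      by exists (cls f (ext f x)); rewrite ?imset_f ?inE.
    - apply/trivIsetP=> _ _ /imsetP[o _ ->] /imsetP[o' _ ->] neq.
      rewrite -setI_eq0; apply/eqP/setP=> x; rewrite !inE.
      by apply/negP=> /andP[/eqP -> /eqP E]; case/eqP: neq; rewrite E.
    - apply/imsetP=> -[o _ E]; have [x Ex] := ext_onto o.
      by have := in_set0 x; rewrite E inE Ex eqxx.
  have block0 : pblock [set cls f o | o : option 'I_j] ord0 = cls f None.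
    apply: def_pblock; rewrite ?imset_f //; first by case/and3P: hpart.
    by rewrite inE /ext unlift_none.
  split.
    apply/andP; split; apply/andP; split=> //=.
    - by rewrite card_imset // card_option card_ord.
    - apply/ffun_onP=> c; rewrite ffunE block0 !inE imset_f // andbT.
      by apply/eqP=> /cls_inj.
    - by apply/injectiveP=> c c'; rewrite !ffunE => /cls_inj[].
  apply/ffunP=> y; rewrite ffunE; case: pickP => [c|no_c] /=.
    by rewrite ffunE inE /ext liftK /= => /eqP.
  case E: (f y) => [c|] //.
  by have := no_c c; rewrite /= ffunE inE /ext liftK /= E eqxx.
move=> /andP[/andP[/= Qpart /eqP cardQ] /andP[/ffun_onP bQ /injectiveP b_inj]].
have [Qcover Qtriv _] := and3P Qpart.
have bcQ c : b c \in Q by have := bQ c; rewrite !inE => /andP[].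
have b_block c x : x \in b c -> pblock Q x = b c by apply: def_pblock.
have b0 c : ord0 \notin b c.
  by apply/negP=> /b_block E; have := bQ c; rewrite -E !inE eqxx.
have extE x c : (ext (g (Q, b)) x == Some c) = (x \in b c).
  rewrite /ext; case: unliftP => [y ->|->] /=; last by rewrite (negbTE (b0 c)).
  rewrite ffunE /=; case: pickP => [c' yc'|no_c]; last by rewrite no_c.
  apply/eqP/idP => [[<-]|yc] //.
  by congr Some; apply: b_inj; rewrite -(b_block _ _ yc') (b_block _ _ yc).
have b_codom : [set b c | c : 'I_j] = Q :\ pblock Q ord0.
  apply/eqP; rewrite eqEcard; apply/andP; split.
    by apply/subsetP=> _ /imsetP[c _ ->]; apply: bQ.
  rewrite card_imset // card_ord -ltnS -cardQ (cardsD1 (pblock Q ord0) Q).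
  by rewrite pblock_mem // (cover_partition Qpart) inE.
have clsS c : cls (g (Q, b)) (Some c) = b c.
  by apply/setP=> x; rewrite inE extE.
have in_block x : x \in pblock Q x by rewrite mem_pblock (eqP Qcover) inE.
have block_in x : pblock Q x \in Q by rewrite pblock_mem // (eqP Qcover) inE.
have clsN : cls (g (Q, b)) None = pblock Q ord0.
  apply/setP=> x; rewrite inE; apply/eqP/idP => [Ex|x0].
    apply: contraTT isT => x0; have : pblock Q x \in [set b c | c : 'I_j].
      by rewrite b_codom !inE block_in andbT; apply: contraNneq x0 => <-.
    by case/imsetP=> c _ E; have := extE x c; rewrite -E in_block Ex.
  case E: (ext _ x) => [c|] //; move/eqP: E; rewrite extE => /b_block E.
  by have := bQ c; rewrite -E !inE (def_pblock Qtriv _ x0) ?eqxx.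
have gb_onto : values (g (Q, b)) == [set: 'I_j].
  apply/eqP/setP=> c; rewrite in_setT; apply/valuesP.
  have [x xc] : exists x, x \in b c.
    by apply/set0Pn; apply: contraTneq (bcQ c) => ->; case/and3P: Qpart.
  move: xc; rewrite -extE /ext; case: unliftP => [y _|_] // /eqP E.
  by exists y.
split=> //; congr (_, _); last by apply/ffunP=> c; rewrite ffunE clsS.
apply/setP=> B; apply/imsetP/idP => [[[c|] _ ->]|BQ].
- by rewrite clsS.
- by rewrite clsN.
have [->|nB] := eqVneq B (pblock Q ord0); first by exists None.
have : B \in [set b c | c : 'I_j] by rewrite b_codom !inE nB.
by case/imsetP=> c _ ->; exists (Some c).
Qed.

Theorem proposition6p1 (r k : nat) (hr : (0 < r)%N) (hk : (0 < k)%N) :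
  boolean_number (complete_bipartite r k) =
  \sum_(1 <= j < r.+1)
    (-1) ^+ (r - j) * j`!%:R * (stirling2 r.+1 j.+1)%:R * j%:R ^+ k.
Proof.
rewrite boolean_number_complete_bipartite big_ltn // expr0n eqn0Ngt hk.
rewrite mulr0 add0r.
by apply: eq_bigr => j _; rewrite pointed_surj_stirling2 natrM mulrA.
Qed.
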